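(* Let $\phi:G\times Q\to Q$ be an action of a Lie group $G$ on $Q$ such that $\phi_g^*\eta=\eta$ for all $g\in G$. Then the principal $\mathbb R$-bundle projection $\mu:T^*Q\to V^*\Pi$ is $G$-equivariant with respect to the cotangent lift $T^*\phi$ of $\phi$ on $T^*Q$ and the action $V^*\phi$ on $V^*\Pi$.
   Context: $Q$ is a connected smooth manifold of dimension $n+1$, $\Pi:Q\to\mathbb R$ is a fibration (surjective submersion), $\eta=\Pi^*(dt)\in\Omega^1(Q)$, and $V\Pi=\{u\in TQ\mid\eta(u)=0\}$ is the vertical bundle, with dual bundle $V^*\Pi$. $\mu:T^*Q\to V^*\Pi$ is the dual map of the inclusion $V\Pi\hookrightarrow TQ$ (restriction of covectors to $V\Pi$); it is a principal $\mathbb R$-bundle with action $\psi(s,\alpha_q)=\alpha_q+s\,\eta(q)$. $T^*\phi$ is defined by $(T_g^*\phi(\alpha_q))(u)=\alpha_q(T_{\phi_g(q)}\phi_{g^{-1}}(u))$ for $g\in G$, $\alpha_q\in T_q^*Q$, $u\in T_{\phi_g(q)}Q$. Since $\eta$ is $G$-invariant, the tangent lift $T\phi$ restricts to $V\Pi$, and $V^*\phi$ is the dual action on $V^*\Pi$: $(V_g^*\phi(\beta_q))(u)=\beta_q(T_{\phi_g(q)}\phi_{g^{-1}}(u))$ for $\beta_q\in V_q^*\Pi$, $u\in V_{\phi_g(q)}\Pi$. *)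

(* Defs.v *)
From HB Require Import structures.
From mathcomp Require Import all_boot all_order all_algebra.
From mathcomp Require Import all_classical all_reals all_analysis.
Set Implicit Arguments.
Unset Strict Implicit.
Unset Printing Implicit Defensive.
Import Order.TTheory GRing.Theory Num.Theory numFieldNormedType.Exports.
Local Open Scope classical_set_scope.
Local Open Scope ring_scope.

(* The C^k class on an open set U, by iterated directional derivatives. *)
Fixpoint Ck (R : realType) (m n k : nat) (U : set 'rV[R]_m)
    (f : 'rV[R]_m -> 'rV[R]_n) : Prop :=
  if k is k'.+1 then
    (forall x, U x -> differentiable f x) /\ (forall v, Ck k' U ('D_v f))
  else forall x, U x -> {for x, continuous f}.

Definition smooth_on (R : realType) (m n : nat) (U : set 'rV[R]_m)
    (f : 'rV[R]_m -> 'rV[R]_n) : Prop :=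
  open U /\ forall k, Ck k U f.

(* [cinv] is total; it is only meaningful on the image of [cdom]. *)
Record chart (R : realType) (m : nat) (M : Type) := Chart {
  cdom : set M;
  cmap :> M -> 'rV[R]_m;
  cinv : 'rV[R]_m -> M }.

Definition is_chart (R : realType) (m : nat) (M : topologicalType)
    (c : chart R m M) : Prop :=
  [/\ open (cdom c), open (c @` cdom c),
      forall p, cdom c p -> cinv c (c p) = p,
      forall p, cdom c p -> {for p, continuous c}
    & forall x, (c @` cdom c) x -> {for x, continuous (cinv c)}].

(* The atlas is not required to be maximal. Smoothness of a map and the tangent
   spaces below do not depend on the choice of a compatible atlas. *)
HB.mixin Record isManifold (R : realType) (m : nat) M of Topological M := {
  atlas : set (chart R m M);
  atlas_chart : forall c, atlas c -> is_chart c;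
  atlas_cover : forall p : M, exists2 c, atlas c & cdom c p;
  atlas_compat : forall c d, atlas c -> atlas d ->
    smooth_on (c @` (cdom c `&` cdom d)) (d \o cinv c);
  manifold_hausdorff : hausdorff_space M;
  manifold_second_countable : @second_countable M }.

#[short(type="manifoldType")]
HB.structure Definition Manifold (R : realType) (m : nat) :=
  { M of isManifold R m M & Topological M }.

Arguments atlas {R m} s : rename.

(* Stated for sets of charts, so that it also applies to [prod_atlas]. *)
Definition smooth_map (R : realType) (m n : nat) (M N : topologicalType)
    (A : set (chart R m M)) (B : set (chart R n N)) (F : M -> N) : Prop :=
  continuous F /\ forall c d, A c -> B d ->
    smooth_on (c @` (cdom c `&` F @^-1` cdom d)) (d \o F \o cinv c).

Definition smooth (R : realType) (m n : nat) (M : manifoldType R m)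
    (N : manifoldType R n) (F : M -> N) : Prop :=
  smooth_map (atlas M) (atlas N) F.

Definition prod_chart (R : realType) (m n : nat) (M N : Type)
    (c : chart R m M) (d : chart R n N) : chart R (m + n) (M * N) :=
  Chart (cdom c `*` cdom d) (fun p => row_mx (c p.1) (d p.2))
        (fun x => (cinv c (lsubmx x), cinv d (rsubmx x))).

Definition prod_atlas (R : realType) (m n : nat) (M : manifoldType R m)
    (N : manifoldType R n) : set (chart R (m + n) (M * N)) :=
  [set prod_chart c d | c in atlas M & d in atlas N].

Arguments prod_atlas {R m n} M N.

HB.mixin Record isLieGroup (R : realType) (m : nat) G
    of Manifold R m G & Group G := {
  smooth_mulg :
    smooth_map (prod_atlas G G) (atlas G) (fun x : G * G => (x.1 * x.2)%g);
  smooth_invg : smooth_map (atlas G) (atlas G) (fun x : G => x^-1%g) }.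

#[short(type="lieGroupType")]
HB.structure Definition LieGroup (R : realType) (m : nat) :=
  { G of isLieGroup R m G & Manifold R m G & Group G }.

Record smooth_action (R : realType) (k m : nat) (G : lieGroupType R k)
    (M : manifoldType R m) := SmoothAction {
  act :> G -> M -> M;
  act1 : forall p, act 1%g p = p;
  actM : forall g h p, act (g * h)%g p = act g (act h p);
  act_smooth :
    smooth_map (prod_atlas G M) (atlas M) (fun x : G * M => act x.1 x.2) }.

Lemma actK (R : realType) (k m : nat) (G : lieGroupType R k)
    (M : manifoldType R m) (phi : smooth_action G M) (g : G) (p : M) :
  phi g^-1%g (phi g p) = p.
Proof. by rewrite -actM mulVg act1. Qed.

Section NearDiff.
Variables (R : realType) (V W : normedModType R).

Lemma near_diff (f g : V -> W) (x : V) : (\forall y \near x, f y = g y) ->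
  differentiable f x -> differentiable g x /\ 'd g x = 'd f x :> (V -> W).
Proof.
move=> fg df; have fgx := nbhs_singleton fg.
suff E : g \o shift x = cst (g x) + 'd f x +o_ 0 id.
  have D := diff_unique (diff_continuous df) E.
  split=> //; apply/diff_locallyP; rewrite D; split => //.
  exact: diff_continuous.
have /eqaddoP E := diff_locally df.
apply/eqaddoP => e e0; have := E _ e0.
have: \forall y \near 0, f (y + x) = g (y + x).
  by have := fg; rewrite (near_shift 0) /= subr0.
by apply: filterS2 => y /= fgy; rewrite !fctE /= -fgx -fgy.
Qed.
End NearDiff.

Section Tangent.
Variables (R : realType) (m : nat) (M : manifoldType R m).

(* A tangent vector at p is a family of coordinate vectors, one for each chart
   around p, related by the differentials of the transition maps. *)
Definition charts_at (p : M) := {c : chart R m M | atlas M c /\ cdom c p}.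

Definition coherent (p : M) : {pred charts_at p -> 'rV[R]_m} :=
  fun v => `[< forall c d : charts_at p,
    v d = 'd (sval d \o cinv (sval c)) (sval c p) (v c) >].

Lemma coherent_submod p : submod_closed (coherent (p := p)).
Proof.
split; first by apply/asboolP => c d; rewrite linear0.
move=> a u v /asboolP hu /asboolP hv; apply/asboolP => c d.
by rewrite linearP -hu -hv.
Qed.

HB.instance Definition _ p :=
  GRing.isSubmodClosed.Build R (charts_at p -> 'rV[R]_m) (coherent (p := p))
    (coherent_submod p).

Record tangent (p : M) := Tangent {
  coords :> charts_at p -> 'rV[R]_m;
  _ : coords \in coherent (p := p) }.

HB.instance Definition _ p := [isSub for @coords p].
HB.instance Definition _ p := [Choice of tangent p by <:].
HB.instance Definition _ p := [SubChoice_isSubLmodule of tangent p by <:].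

End Tangent.

Section Charts.
Variables (R : realType) (m : nat) (M : manifoldType R m) (p : M).

Definition chart_at : charts_at p :=
  let: exist2 c cA cp := cid2 (atlas_cover p) in exist _ c (conj cA cp).

Lemma chart_is_chart (c : charts_at p) : is_chart (sval c).
Proof. by case: c => c [cA ?]; exact: atlas_chart cA. Qed.

Lemma cinvK (c : charts_at p) : cinv (sval c) (sval c p) = p.
Proof. by have [_ _ + _ _] := chart_is_chart c; apply; case: c => c []. Qed.

Lemma cinv_cvg (c : charts_at p) : cinv (sval c) @ sval c p --> p.
Proof.
have [_ _ _ _ h] := chart_is_chart c; rewrite -[X in _ --> X](cinvK c).
by apply: h; exists p => //; case: c => c [].
Qed.

Lemma transition_diff (c d : charts_at p) :
  differentiable (sval d \o cinv (sval c)) (sval c p).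
Proof.
case: c d => c [cA cp] [d [dA dp]] /=.
by have [_ /(_ 1%N) [+ _]] := atlas_compat _ _ cA dA; apply; exists p.
Qed.

Lemma near_cinv (c d : charts_at p) :
  \forall x \near sval c p, cdom (sval d) (cinv (sval c) x).
Proof.
apply: cinv_cvg; have [dO _ _ _ _] := chart_is_chart d.
by apply: open_nbhs_nbhs; split => //; case: d {dO} => d [].
Qed.

End Charts.

(* [mdiff F p] is the tangent map T_pF, computed in charts. Like 'd, it is total:
   it is 0 when F is not differentiable at p. [mdiffE] shows that the chart
   chosen around p is irrelevant, [mdiff_comp] is the chain rule. *)
Section TangentMap.
Variables (R : realType) (m n : nat).
Variables (M : manifoldType R m) (N : manifoldType R n).

Definition mdifferentiable (F : M -> N) (p : M) : Prop :=
  {for p, continuous F} /\ forall (c : charts_at p) (d : charts_at (F p)),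
    differentiable (sval d \o F \o cinv (sval c)) (sval c p).

Definition mdiff_coords (F : M -> N) (p : M) (u : tangent p)
    (d : charts_at (F p)) : 'rV[R]_n :=
  if `[< mdifferentiable F p >] then
    'd (sval d \o F \o cinv (sval (chart_at p))) (sval (chart_at p) p)
      (u (chart_at p))
  else 0.

Lemma tangentP (p : M) (u : tangent p) (c d : charts_at p) :
  u d = 'd (sval d \o cinv (sval c)) (sval c p) (u c).
Proof. by case: u => u /= /asboolP; apply. Qed.

Section At.
Variables (F : M -> N) (p : M).

Lemma near_map_cinv (c : charts_at p) (d : charts_at (F p)) :
  mdifferentiable F p ->
  \forall x \near sval c p, cdom (sval d) (F (cinv (sval c) x)).
Proof.
move=> [Fc _]; have [dO _ _ _ _] := chart_is_chart d.
apply: (cvg_comp _ _ (cinv_cvg c) Fc).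
by apply: open_nbhs_nbhs; split => //; case: d {dO} => d [].
Qed.

Lemma diff_change_target (c : charts_at p) (d e : charts_at (F p)) :
  mdifferentiable F p ->
  'd (sval e \o F \o cinv (sval c)) (sval c p) =
  'd (sval e \o cinv (sval d)) (sval d (F p)) \o
  'd (sval d \o F \o cinv (sval c)) (sval c p) :> (_ -> _).
Proof.
move=> dF; have Ep : (sval d \o F \o cinv (sval c)) (sval c p) = sval d (F p).
  by rewrite /= cinvK.
rewrite -Ep -diff_comp; last 2 first.
- exact: dF.2.
- by rewrite Ep; exact: transition_diff.
apply: (near_diff _ _).2; last first.
  apply: differentiable_comp; first exact: dF.2.
  by rewrite Ep; exact: transition_diff.
have [_ _ dK _ _] := chart_is_chart d.
by apply: filterS (near_map_cinv c d dF) => x /= dx; rewrite dK.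
Qed.

Lemma diff_change_source (b c : charts_at p) (d : charts_at (F p)) :
  mdifferentiable F p ->
  'd (sval d \o F \o cinv (sval c)) (sval c p) =
  'd (sval d \o F \o cinv (sval b)) (sval b p) \o
  'd (sval b \o cinv (sval c)) (sval c p) :> (_ -> _).
Proof.
move=> dF; have Ep : (sval b \o cinv (sval c)) (sval c p) = sval b p.
  by rewrite /= cinvK.
rewrite -Ep -diff_comp; last 2 first.
- exact: transition_diff.
- by rewrite Ep; exact: dF.2.
apply: (near_diff _ _).2; last first.
  apply: differentiable_comp; first exact: transition_diff.
  by rewrite Ep; exact: dF.2.
have [_ _ bK _ _] := chart_is_chart b.
by apply: filterS (near_cinv c b) => x /= dx; rewrite bK.
Qed.

Lemma mdiff_coherent (u : tangent p) : mdiff_coords u \in coherent (p := F p).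
Proof.
apply/asboolP => d e; rewrite /mdiff_coords.
case: asboolP => [dF|_]; last exact/esym/linear0.
exact: (congr1 (@^~ _) (diff_change_target _ d e dF)).
Qed.

Definition mdiff_fun (u : tangent p) : tangent (F p) :=
  Tangent (mdiff_coherent u).

Lemma mdiff_is_linear : linear mdiff_fun.
Proof.
move=> a u v; apply: val_inj; apply/funext => d; rewrite -[RHS]/(a *: mdiff_coords u d + mdiff_coords v d) /= /mdiff_coords.
by case: asboolP => _; [exact: linearP | rewrite scaler0 addr0].
Qed.

HB.instance Definition _ :=
  GRing.isLinear.Build R (tangent p) (tangent (F p)) *:%R mdiff_fun mdiff_is_linear.

Definition mdiff : {linear tangent p -> tangent (F p)} := mdiff_fun.

Lemma mdiffE (u : tangent p) (c : charts_at p) (d : charts_at (F p)) :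
  mdifferentiable F p ->
  mdiff u d = 'd (sval d \o F \o cinv (sval c)) (sval c p) (u c).
Proof.
move=> dF; rewrite /= /mdiff_coords; case: asboolP => // _.
rewrite (tangentP u c (chart_at p)).
exact: (congr1 (@^~ _) (esym (diff_change_source (chart_at p) c d dF))).
Qed.

End At.
End TangentMap.

Section RealLine.
Variable R : realType.

Definition real_line : Type := R.

HB.instance Definition _ := Topological.copy real_line R^o.

Definition std_chart : chart R 1 real_line :=
  Chart setT (fun t : real_line => const_mx t) (fun x => x 0 0).

Lemma const_mx_continuous : continuous (const_mx : R^o -> 'rV[R]_1).
Proof.
have -> : const_mx = ( *:%R^~ (const_mx 1)) :> (R^o -> 'rV[R]_1).
  by apply/funext => t; apply/rowP => i; rewrite !mxE mulr1.
exact: scalel_continuous.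
Qed.

Lemma std_chart_is_chart : is_chart std_chart.
Proof.
have imT : std_chart @` cdom std_chart = setT.
  apply/seteqP; split => // x _; exists (x 0 0) => //=.
  by apply/rowP => i; rewrite !mxE !ord1.
split; rewrite ?imT; [exact: openT | exact: openT | |  | ].
- by move=> p _; rewrite /= mxE.
- by move=> p _; exact: const_mx_continuous.
- by move=> x _; exact: coord_continuous.
Qed.

Lemma Ck_cst k m n (U : set 'rV[R]_m) (a : 'rV[R]_n) : Ck k U (cst a).
Proof.
elim: k a => [|k IH] a /=; first by move=> x _; exact: cst_continuous.
split=> [x _|v]; first exact: differentiable_cst.
suff -> : 'D_v (cst a) = cst 0 :> ('rV[R]_m -> 'rV[R]_n) by exact: IH.
by apply/funext => x; exact: derive_cst.
Qed.

Lemma Ck_id k n (U : set 'rV[R]_n) : Ck k U (@id 'rV[R]_n).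
Proof.
case: k => [|k] /=; first by move=> x _.
split=> [x _|v]; first exact: ex_diff.
suff -> : 'D_v (@id 'rV[R]_n) = cst v by exact: Ck_cst.
by apply/funext => x; exact: derive_id.
Qed.

Lemma real_line_compat (c d : chart R 1 real_line) :
  [set std_chart] c -> [set std_chart] d ->
  smooth_on (c @` (cdom c `&` cdom d)) (d \o cinv c).
Proof.
move=> -> ->; rewrite setIid; split; first by case: std_chart_is_chart.
suff -> : std_chart \o cinv std_chart = id by move=> k; exact: Ck_id.
by apply/funext => x; apply/rowP => i; rewrite !mxE !ord1.
Qed.

Lemma real_line_second_countable : @second_countable real_line.
Proof.
exists [set `]ratr x.1 : R, ratr x.2[%classic | x in [set: rat * rat]].
  apply: sub_countable (card_image_le _ _) _; exact: countableP.
split=> [_ [x _ <-]|x A /nbhs_ballP[e /= e0 xeA]]; first exact: interval_open.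
have [a ax] : exists a, ratr a \in `]x - e, x[.
  by apply: rat_in_itvoo; rewrite ltrBlDr ltrDl.
have [b xb] : exists b, ratr b \in `]x, x + e[.
  by apply: rat_in_itvoo; rewrite ltrDl.
move: ax xb; rewrite !in_itv /= => /andP[ea ax] /andP[xb be].
exists (`]ratr a : R, ratr b[%classic).
  by split; [exists (a, b) | rewrite /= in_itv /= ax xb].
move=> y; rewrite /= in_itv /= => /andP[ay yb]; apply: xeA.
rewrite /ball /= ltr_distlC; apply/andP; split.
  exact: lt_trans ea ay.
exact: lt_trans yb be.
Qed.

Lemma real_line_cover (t : real_line) :
  exists2 c, [set std_chart] c & cdom c t.
Proof. by exists std_chart. Qed.

Lemma real_line_atlas_chart c : [set std_chart] c -> is_chart c.
Proof. by move=> ->; exact: std_chart_is_chart. Qed.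

HB.instance Definition _ := isManifold.Build R 1 real_line
  real_line_atlas_chart real_line_cover real_line_compat
  (@Rhausdorff R) real_line_second_countable.

End RealLine.

Section Cast.
Variables (R : realType) (m : nat) (M : manifoldType R m).

(* The identification of T_pM and T_qM along a proof of p = q. *)
Definition tcast (p q : M) (e : p = q) : {linear tangent p -> tangent q} :=
  match e in _ = q' return {linear tangent p -> tangent q'} with
  | erefl => idfun
  end.

End Cast.

Section Forms.
Variables (R : realType) (m : nat) (M : manifoldType R m).

Definition cotangent (p : M) := {linear tangent p -> R^o}.

Definition one_form := forall p : M, cotangent p.

Definition pullback n (N : manifoldType R n) (F : M -> N)
    (omega : forall p : N, {linear tangent p -> R^o}) : one_form :=
  fun p => omega (F p) \o mdiff F p.

End Forms.

Section Dt.
Variable (R : realType).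

Definition std_chart_at (t : real_line R) : charts_at t :=
  exist _ (std_chart R) (conj erefl I).

(* dt reads the coordinate of a tangent vector in the global chart t. *)
Definition dt_fun (t : real_line R) (u : tangent t) : R^o := u (std_chart_at t) 0 0.

Lemma dt_is_linear t : linear (@dt_fun t).
Proof. by move=> a u v; rewrite /dt_fun /= !mxE. Qed.

HB.instance Definition _ t :=
  GRing.isLinear.Build R (tangent t) R^o *:%R (@dt_fun t) (@dt_is_linear t).

Definition dt : one_form (real_line R) := fun t => @dt_fun t.
End Dt.

Section Functoriality.
Variables (R : realType).

Lemma mdifferentiable_id m (M : manifoldType R m) (p : M) :
  mdifferentiable (@id M) p.
Proof. by split=> [|c d]; [exact: cvg_id | exact: transition_diff]. Qed.

Lemma mdiff_id m (M : manifoldType R m) (p : M) (u : tangent p) :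
  mdiff (@id M) p u = u.
Proof.
apply: val_inj; apply/funext => d.
by rewrite [LHS](mdiffE u d d (mdifferentiable_id p)) -(tangentP u d d).
Qed.

Lemma mdiff_comp m n k (M : manifoldType R m) (N : manifoldType R n)
    (P : manifoldType R k) (F : M -> N) (H : N -> P) (p : M) (u : tangent p) :
  mdifferentiable F p -> mdifferentiable H (F p) ->
  mdifferentiable (H \o F) p /\ mdiff (H \o F) p u = mdiff H (F p) (mdiff F p u).
Proof.
move=> dF dH; pose b := chart_at (F p).
have FE (c : charts_at p) : (sval b \o F \o cinv (sval c)) (sval c p) = sval b (F p).
  by rewrite /= cinvK.
have near_eq (c : charts_at p) (d : charts_at ((H \o F) p)) :
    \forall x \near sval c p,
     ((sval d \o H \o cinv (sval b)) \o (sval b \o F \o cinv (sval c))) x =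
     (sval d \o (H \o F) \o cinv (sval c)) x.
  have [_ _ bK _ _] := chart_is_chart b.
  by apply: filterS (near_map_cinv c b dF) => x /= dx; rewrite bK.
have dcomp (c : charts_at p) (d : charts_at ((H \o F) p)) : differentiable
    ((sval d \o H \o cinv (sval b)) \o (sval b \o F \o cinv (sval c)))
    (sval c p).
  by apply: differentiable_comp; [exact: dF.2 | rewrite FE; exact: dH.2].
have dHF : mdifferentiable (H \o F) p.
  split=> [|c d]; last exact: (near_diff (near_eq c d) (dcomp c d)).1.
  by apply: continuous_comp; [exact: dF.1 | exact: dH.1].
split=> //; apply: val_inj; apply/funext => d.
pose c := chart_at p.
rewrite [LHS](mdiffE u c d dHF) [RHS](mdiffE _ b d dH) (mdiffE u c b dF).
rewrite (near_diff (near_eq c d) (dcomp c d)).2 diff_comp ?FE//.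
  exact: dF.2.
exact: dH.2.
Qed.

Lemma tcast_mdiff_eq m n (M : manifoldType R m) (N : manifoldType R n)
    (F H : M -> N) (p : M) (r : N) (e : F p = r) (e' : H p = r) u :
  F =1 H -> tcast e (mdiff F p u) = tcast e' (mdiff H p u).
Proof.
move=> /funext FH; case: H / FH e' => e'.
by rewrite (Prop_irrelevance e e').
Qed.

Lemma tcast_mdiff m n (M : manifoldType R m) (N : manifoldType R n)
    (F : M -> N) (p q : M) (r : N) (e : p = q) (e' : F q = r) u :
  tcast e' (mdiff F q (tcast e u)) = tcast (etrans (congr1 F e) e') (mdiff F p u).
Proof. by case: q / e e' => e'; congr (tcast _ _); exact: Prop_irrelevance. Qed.

Lemma row_mx_differentiable m n (a : 'rV[R]_m) (x : 'rV[R]_n) :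
  differentiable (row_mx a : 'rV[R]_n -> 'rV[R]_(m + n)) x.
Proof.
pose L : {linear 'rV[R]_n -> 'rV[R]_(m + n)} := mulmxr (row_mx 0 1%:M).
have LE y : L y = row_mx 0 y by rewrite /= mul_mx_row mulmx0 mulmx1.
have -> : row_mx a = cst (row_mx a 0) + L :> ('rV[R]_n -> 'rV[R]_(m + n)).
  by apply/funext => y; rewrite -[RHS]/(row_mx a 0 + L y) LE add_row_mx addr0 add0r.
apply: differentiableD; first exact: differentiable_cst.
apply: linear_differentiable => y A; rewrite LE => -[P Py PA].
exists (fun i j => P i (rshift m j)) => [i j|z Pz].
  by have := Py i (rshift m j); rewrite row_mxEr.
apply: PA => i j; rewrite LE; case: (split_ordP j) => k ->.
  by have /nbhs_singleton := Py i (lshift n k); rewrite !row_mxEl !mxE.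
by rewrite row_mxEr; exact: Pz.
Qed.

Lemma act_mdifferentiable k m (G : lieGroupType R k) (M : manifoldType R m)
    (phi : smooth_action G M) (g : G) (p : M) : mdifferentiable (phi g) p.
Proof.
have [phic phis] := act_smooth phi; split=> [|c d].
  have gq : (fun q : M => (g, q)) @ p --> (g, p).
    by apply: cvg_pair; [exact: cvg_cst | exact: cvg_id].
  exact: (cvg_comp _ _ gq (phic (g, p))).
pose b := chart_at g; pose bc := prod_chart (sval b) (sval c).
have bcA : prod_atlas G M bc.
  by exists (sval b); [exact: (svalP b).1 | exists (sval c); [exact: (svalP c).1|]].
have [_ /(_ 1%N)[dphi _]] := phis _ _ bcA (svalP d).1.
have -> : sval d \o phi g \o cinv (sval c) =
    (sval d \o (fun x : G * M => phi x.1 x.2) \o cinv bc) \o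
    row_mx (sval b g).
  by apply/funext => x; rewrite /= row_mxKl row_mxKr cinvK.
apply: differentiable_comp; first exact: row_mx_differentiable.
apply: dphi; exists (g, p) => //; split; last exact: (svalP d).2.
by split; [exact: (svalP b).2 | exact: (svalP c).2].
Qed.

End Functoriality.

Section Vertical.
Variables (R : realType) (m : nat) (M : manifoldType R m).
Variable Pi : M -> real_line R.

Definition eta_form : one_form M := pullback Pi (@dt R).

Definition fibration : Prop :=
  [/\ smooth Pi, forall t, exists q, Pi q = t
    & forall q (w : tangent (Pi q)), exists u, mdiff Pi q u = w].

Definition is_vertical (q : M) : {pred tangent q} := fun u => eta_form q u == 0.

Lemma vertical_submod q : submod_closed (is_vertical (q := q)).
Proof.
split=> [|a u v]; rewrite !unfold_in ?linear0// => /eqP hu /eqP hv.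
by rewrite linearP hu hv scaler0 addr0.
Qed.

HB.instance Definition _ q :=
  GRing.isSubmodClosed.Build R (tangent q) (is_vertical (q := q))
    (vertical_submod q).

Record vertical (q : M) := Vertical {
  vval :> tangent q;
  _ : vval \in is_vertical (q := q) }.

HB.instance Definition _ q := [isSub for @vval q].
HB.instance Definition _ q := [Choice of vertical q by <:].
HB.instance Definition _ q := [SubChoice_isSubLmodule of vertical q by <:].

Definition covertical (q : M) := {linear vertical q -> R^o}.

End Vertical.

Definition cotangent_bundle (R : realType) (m : nat) (M : manifoldType R m) :=
  {q : M & cotangent q}.

Definition covertical_bundle (R : realType) (m : nat) (M : manifoldType R m)
    (Pi : M -> real_line R) :=
  {q : M & covertical Pi q}.

(* Restriction of covectors, the dual of the inclusion [val] of the vertical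
   bundle in the tangent bundle. *)
Definition mu_map (R : realType) (m : nat) (M : manifoldType R m)
    (Pi : M -> real_line R) (a : cotangent_bundle M) : covertical_bundle Pi :=
  existT (covertical Pi) (projT1 a)
    (projT2 a \o val : {linear vertical Pi (projT1 a) -> R^o}).

Record group_action (G : groupType) (X : Type) := GroupAction {
  gact :> G -> X -> X;
  gact1 : forall x, gact 1%g x = x;
  gactM : forall g h x, gact (g * h)%g x = gact g (gact h x) }.

Definition equivariant (G : groupType) (X Y : Type) (a : group_action G X)
    (b : group_action G Y) (f : X -> Y) : Prop :=
  forall g x, f (a g x) = b g (f x).

Lemma linear_ext (R : realType) (U V : lmodType R) (f g : {linear U -> V}) :
  f =1 g -> f = g.
Proof.
move=> /funext; case: f => f hf; case: g => g hg /= fg; subst g.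
congr GRing.Linear.Pack; case: hf hg => [[x] [y]] [[x'] [y']].
by rewrite (Prop_irrelevance x x') (Prop_irrelevance y y').
Qed.

Section Lifts.
Variables (R : realType) (k m : nat) (G : lieGroupType R k).
Variables (M : manifoldType R m) (phi : smooth_action G M).

(* T_{phi_g(q)} phi_{g^-1}, whose codomain is T_qM since
   phi_{g^-1}(phi_g(q)) = q. *)
Definition tinv (g : G) (q : M) : {linear tangent (phi g q) -> tangent q} :=
  tcast (actK phi g q) \o mdiff (phi g^-1%g) (phi g q).

Lemma tinv1 (q : M) u : tinv 1%g q u = tcast (act1 phi q) u.
Proof.
have E : phi 1^-1%g =1 id by move=> x; rewrite invg1 act1.
rewrite -[u in RHS]mdiff_id.
exact: (tcast_mdiff_eq (actK phi 1%g q) (act1 phi q) u E).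
Qed.

Lemma tinvM (g h : G) (q : M) u :
  tinv (g * h)%g q u = tinv h q (tinv g (phi h q) (tcast (actM phi g h q) u)).
Proof.
have dg := act_mdifferentiable phi g^-1%g (phi (g * h)%g q).
have dh := act_mdifferentiable phi h^-1%g (phi g^-1%g (phi (g * h)%g q)).
have [_ E] := mdiff_comp u dg dh.
rewrite /tinv -[RHS]/(tcast _ (mdiff _ _ (tcast _ (mdiff _ _ (tcast _ u))))).
rewrite (tcast_mdiff (actM phi g h q) (actK phi g (phi h q))).
rewrite tcast_mdiff -E.
set e := etrans _ _.
have F : phi (g * h)^-1%g =1 phi h^-1%g \o phi g^-1%g.
  by move=> x; rewrite /= -actM invgM.
exact (tcast_mdiff_eq (actK phi (g * h)%g q) e u F).
Qed.

Lemma cotangent_bundle_eq (p q : M) (e : p = q) (al : cotangent p)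
    (be : cotangent q) : (forall u, al u = be (tcast e u)) ->
  existT (@cotangent _ _ M) p al = existT (@cotangent _ _ M) q be.
Proof. by case: q / e be => be E; congr existT; exact: linear_ext. Qed.

Definition cotangent_lift_fun (g : G) (a : cotangent_bundle M) :
    cotangent_bundle M :=
  existT (@cotangent _ _ M) (phi g (projT1 a))
    (projT2 a \o tinv g (projT1 a) : {linear _ -> R^o}).

Lemma cotangent_lift1 a : cotangent_lift_fun 1%g a = a.
Proof.
case: a => q al; apply: (cotangent_bundle_eq (e := act1 phi q)) => u.
exact: (congr1 al (tinv1 u)).
Qed.

Lemma cotangent_liftM g h a :
  cotangent_lift_fun (g * h)%g a = cotangent_lift_fun g (cotangent_lift_fun h a).
Proof.
case: a => q al; apply: (cotangent_bundle_eq (e := actM phi g h q)) => u.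
exact: (congr1 al (tinvM u)).
Qed.

Definition cotangent_lift : group_action G (cotangent_bundle M) :=
  GroupAction cotangent_lift1 cotangent_liftM.

Variable Pi : M -> real_line R.
Hypothesis eta_inv : forall g : G, pullback (phi g) (eta_form Pi) = eta_form Pi.

Lemma eta_tcast (p q : M) (e : p = q) u : eta_form Pi q (tcast e u) = eta_form Pi p u.
Proof. by case: q / e. Qed.

Lemma tinv_vertical (g : G) (q : M) (u : vertical Pi (phi g q)) :
  tinv g q (val u) \in is_vertical Pi (q := q).
Proof.
case: u => u uV; rewrite unfold_in.
rewrite -[X in eta_form Pi q X]/(tcast (actK phi g q) (mdiff _ _ u)) eta_tcast.
by rewrite -[eta_form Pi _ _]/(pullback (phi g^-1%g) (eta_form Pi) (phi g q) u) eta_inv.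
Qed.

(* [tinv] restricted to vertical vectors. *)
Definition vinv_fun (g : G) (q : M) (u : vertical Pi (phi g q)) :
    vertical Pi q :=
  Vertical (tinv_vertical u).

Lemma vinv_is_linear (g : G) (q : M) : linear (@vinv_fun g q).
Proof. by move=> a u v; apply: val_inj; exact: linearP. Qed.

HB.instance Definition _ (g : G) (q : M) :=
  GRing.isLinear.Build R (vertical Pi (phi g q)) (vertical Pi q) *:%R
    (@vinv_fun g q) (@vinv_is_linear g q).

Definition vinv (g : G) (q : M) :
  {linear vertical Pi (phi g q) -> vertical Pi q} := @vinv_fun g q.

Lemma covertical_bundle_eq (p q : M) (e : p = q) (al : covertical Pi p)
    (be : covertical Pi q) :
  (forall u w, val w = tcast e (val u) -> al u = be w) ->
  existT (covertical Pi) p al = existT (covertical Pi) q be.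
Proof.
by case: q / e be => be E; congr existT; apply: linear_ext => u; exact: E.
Qed.

Definition covertical_lift_fun (g : G) (b : covertical_bundle Pi) :
    covertical_bundle Pi :=
  existT (covertical Pi) (phi g (projT1 b))
    (projT2 b \o vinv g (projT1 b) : {linear _ -> R^o}).

Lemma covertical_lift1 b : covertical_lift_fun 1%g b = b.
Proof.
case: b => q be; apply: (covertical_bundle_eq (e := act1 phi q)) => u w E.
congr (be _); apply: val_inj; rewrite E.
exact: (tinv1 (val u)).
Qed.

Lemma covertical_liftM g h b :
  covertical_lift_fun (g * h)%g b =
  covertical_lift_fun g (covertical_lift_fun h b).
Proof.
case: b => q be; apply: (covertical_bundle_eq (e := actM phi g h q)) => u w E.
congr (be _); apply: val_inj; apply: etrans (tinvM (val u)) _.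
by rewrite -E.
Qed.

Definition covertical_lift : group_action G (covertical_bundle Pi) :=
  GroupAction covertical_lift1 covertical_liftM.

End Lifts.

(* Main.v *)
Require Import Defs.
From HB Require Import structures.
From mathcomp Require Import all_boot all_order all_algebra.
From mathcomp Require Import all_classical all_reals all_analysis.
Local Open Scope classical_set_scope.

(** Both lifts precompose a functional with the tangent map of [phi g^-1], which by [eta_inv] sends
    vertical vectors to vertical vectors. Precomposing and then restricting to vertical vectors is
    therefore the same as restricting and then precomposing. *)

Theorem proposition3p4 (R : realType) (n k : nat) (Q : manifoldType R n.+1)
    (Q_connected : connected [set: Q])
    (Pi : Q -> real_line R) (Pi_fibration : fibration Pi)
    (G : lieGroupType R k) (phi : smooth_action G Q)
    (eta_inv : forall g : G, pullback (phi g) (eta_form Pi) = eta_form Pi) :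
  equivariant (cotangent_lift phi) (covertical_lift eta_inv) (mu_map Pi).
Proof.
(* Both sides lie over [phi g q] by computation, so the transport is along [erefl] and [val_inj]
   identifies [w] with [u]. Both functionals then reduce to [al (tinv phi g q (val u))]. *)
by move=> g [q al]; apply: (covertical_bundle_eq (e := erefl)) => u w /= /val_inj ->.
Qed.
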